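(* For every integer $n\ge1$, let $\gamma^{\mathrm{peak}}_{\mathcal A(2n)}(t)$ be the gamma-polynomial of the symmetric polynomial $\mathrm{Peak}_{\mathcal A(2n)}(t)/t$, where $\mathrm{Peak}_{\mathcal A(m)}(t)=\sum_{\mathbf a\in\mathcal A(m)}t^{\mathrm{peak}(\mathbf a)}$. Then $$\gamma^{\mathrm{peak}}_{\mathcal A(2n)}(t)=\sum_{i=0}^{\lfloor\frac n2\rfloor}2^{2i}\binom{n}{2i}t^i=\frac{(1+2\sqrt t)^n+(1-2\sqrt t)^n}{2}.$$ Moreover, for each such $i$, $2^{2i}\binom{n}{2i}$ is the number of Abelian Dyck paths $(k,L)$ of semilength $2n$ with $i+1$ peaks such that, writing the augmented word $LE=S_1S_2\cdots S_{2n}S_{2n+1}$ (obtained by appending a step $E$ to $L$), there is no $j\in[n]$ with $S_{2j-1}S_{2j}S_{2j+1}=ENE$ or $S_{2j-1}S_{2j}S_{2j+1}=NEN$.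
   Context: Write $[n]=\{1,\dots,n\}$. An area sequence of size $m$ is a sequence $\mathbf a=(a_1,\dots,a_m)$ of nonnegative integers with $a_i<i$ for all $i$ and $a_i\le a_{i-1}+1$ for all $i\ge 2$. Each area sequence $\mathbf a$ defines a graph $\Gamma_{\mathbf a}$ (a unit interval graph) on $[m]$ with edges $\{j,i\}$ for $1\le j<i\le m$ with $i-a_i\le j$. A peak-edge of $\Gamma_{\mathbf a}$ is either an isolated vertex or an edge $\{i,j\}$, $i<j$, such that neither $\{i,j+1\}$ nor $\{i-1,j\}$ is an edge (pairs not contained in $[m]$ are not edges); $\mathrm{peak}(\mathbf a)$ is the number of peak-edges. $\mathbf a$ is Abelian if every vertex $i\ne 1,m$ of $\Gamma_{\mathbf a}$ is adjacent to at least one of $1$ and $m$; $\mathcal A(m)$ is the set of Abelian area sequences of size $m$. Area sequences of size $m$ correspond bijectively to Dyck paths of semilength $m$, i.e. lattice paths from $(0,0)$ to $(m,m)$ with steps $N=(0,1)$, $E=(1,0)$ staying weakly above the diagonal: the $i$-th $N$ step of the path lies on the line $x=i-1-a_i$. A peak of a Dyck path is an $N$ step immediately followed by an $E$ step; the number of peaks of the path equals $\mathrm{peak}(\mathbf a)$. A Dyck path is Abelian if its area sequence is. Every Abelian Dyck path of semilength $m$ is uniquely of the form $N^kLE^{m-k}$ with $1\le k\le m$ and $L$ a path with steps $N,E$ from $(0,k)$ to $(k,m)$ whose first step is $E$; it is denoted $(k,L)$, and conversely each such pair gives an Abelian Dyck path. The peaks counted are those of the whole Dyck path $(k,L)$.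 A polynomial $p(t)$ of degree $d$ is symmetric if $p(t)=t^dp(1/t)$; then $p(t)=\sum_{0\le 2i\le d}\gamma_it^i(1+t)^{d-2i}$ uniquely and $\gamma_p(t)=\sum_i\gamma_it^i$ is its gamma-polynomial. *)

(* Defs.v *)
From HB Require Import structures.
From mathcomp Require Import all_boot all_order all_algebra.

Set Implicit Arguments.
Unset Strict Implicit.
Unset Printing Implicit Defensive.

Import GRing.Theory.

(* Area sequences are nat sequences read with 1-based indices, and the vertices
   of the associated graph are the naturals 1, ..., size a.  As the index 0 and
   the indices above [size a] are never incident to an edge, [{i-1, j}] and
   [{i, j+1}] need no boundary cases. *)

Definition entry (a : seq nat) (i : nat) : nat := nth 0 a i.-1.

Definition area_seq (m : nat) (a : seq nat) : bool :=
  [&& size a == m,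
      all (fun i => entry a i < i) (iota 1 m) &
      all (fun i => entry a i <= (entry a i.-1).+1) (iota 2 m.-1)].

(* The edge {j, i} written with j < i. *)
Definition edge (a : seq nat) (j i : nat) : bool :=
  [&& 1 <= j, j < i, i <= size a & i - entry a i <= j].

Definition adjacent (a : seq nat) (i j : nat) : bool := edge a i j || edge a j i.

Definition isolated (a : seq nat) (i : nat) : bool :=
  all (fun j => ~~ adjacent a i j) (iota 1 (size a)).

Definition proper_peak_edge (a : seq nat) (i j : nat) : bool :=
  [&& edge a i j, ~~ edge a i j.+1 & ~~ edge a i.-1 j].

Definition peak (a : seq nat) : nat :=
  count (isolated a) (iota 1 (size a)) +
  count (fun e => proper_peak_edge a e.1 e.2)
    [seq (i, j) | i <- iota 1 (size a), j <- iota 1 (size a)].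

Definition abelian_seq (a : seq nat) : bool :=
  all (fun i => [|| i == 1, i == size a, adjacent a i 1 | adjacent a i (size a)])
      (iota 1 (size a)).

(* Since a_i < i <= m, every area sequence of size m is an m-tuple over 'I_m. *)
Definition abelian_area_seqs (m : nat) : {set m.-tuple 'I_m} :=
  [set a : m.-tuple 'I_m |
    area_seq m (map val a) && abelian_seq (map val a)].

Variant step := North | East.

Definition bool_of_step (s : step) : bool := if s is North then true else false.
Definition step_of_bool (b : bool) : step := if b then North else East.
Lemma bool_of_stepK : cancel bool_of_step step_of_bool.
Proof. by case. Qed.
HB.instance Definition _ := Equality.copy step (can_type bool_of_stepK).
HB.instance Definition _ := Choice.copy step (can_type bool_of_stepK).
HB.instance Definition _ := Countable.copy step (can_type bool_of_stepK).
HB.instance Definition _ := Finite.copy step (can_type bool_of_stepK).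

Definition num_N (w : seq step) : nat := count_mem North w.
Definition num_E (w : seq step) : nat := count_mem East w.

Definition endpoint (p : nat * nat) (w : seq step) : nat * nat :=
  (p.1 + num_E w, p.2 + num_N w).

Definition dyck (m : nat) (w : seq step) : bool :=
  (endpoint (0, 0) w == (m, m)) &&
  all (fun l => num_E (take l w) <= num_N (take l w)) (iota 0 (size w).+1).

(* If the i-th N step is at position p of the word, it lies on the line
   x = num_E (take p w), while i - 1 = num_N (take p w). *)
Definition area_of_path (w : seq step) : seq nat :=
  [seq num_N (take p w) - num_E (take p w)
  | p <- iota 0 (size w) & nth East w p == North].

Definition path_peaks (w : seq step) : nat :=
  count_mem (North, East) (zip w (behead w)).

Definition abelian_dyck (m : nat) (w : seq step) : bool :=
  dyck m w && abelian_seq (area_of_path w).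

(* w is the path (k, L). *)
Definition is_kL (m k : nat) (L w : seq step) : bool :=
  [&& 1 <= k <= m,
      endpoint (0, k) L == (k, m),
      ohead L == Some East &
      w == nseq k North ++ L ++ nseq (m - k) East].

(* S_{2j-1} S_{2j} S_{2j+1} with j in [n] is the factor of length 3 starting at
   the 0-based position 2(j-1). *)
Definition avoids_ENE_NEN (n : nat) (L : seq step) : bool :=
  [forall j : 'I_n,
    take 3 (drop (2 * j) (rcons L East)) \notin
      [:: [:: East; North; East]; [:: North; East; North]]].

(* A path from (0, k) to (k, m) has exactly m steps. *)
Definition avoiding_abelian_dyck (n r : nat) :
    {set (2 * n + 2 * n).-tuple step} :=
  [set w : (2 * n + 2 * n).-tuple step |
    [&& abelian_dyck (2 * n) w, path_peaks w == r &
        [exists k : 'I_(2 * n).+1, exists L : (2 * n).-tuple step,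
          is_kL (2 * n) k L w && avoids_ENE_NEN n L]]].

Local Open Scope ring_scope.

Definition Peak_poly (m : nat) : {poly rat} :=
  \sum_(a in abelian_area_seqs m) 'X^(peak (map val a)).

Definition degree (p : {poly rat}) : nat := (size p).-1.

(* p(t) = t^d p(1/t); the field of rationals being infinite, the pointwise
   identity is the identity of rational functions. *)
Definition symmetric_poly (p : {poly rat}) : Prop :=
  forall t : rat, t != 0 -> p.[t] = t ^+ degree p * p.[t^-1].

Definition gamma_expansion (d : nat) (g : {poly rat}) : {poly rat} :=
  \sum_(i < (d./2).+1) g`_i *: ('X^i * (1 + 'X) ^+ (d - 2 * i)).

(* The bound on the size says that g has no coefficient beyond gamma_(d/2). *)
Definition is_gamma_poly (p g : {poly rat}) : Prop :=
  [/\ symmetric_poly p,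
      (size g <= ((degree p)./2).+1)%N &
      p = gamma_expansion (degree p) g].

Lemma gamma_poly_unique (p g h : {poly rat}) :
  is_gamma_poly p g -> is_gamma_poly p h -> g = h.
Proof.
case=> _ sg Eg [_ sh Eh]; set d := degree p in sg Eg sh Eh.
have Egh : gamma_expansion d g = gamma_expansion d h by rewrite -Eg -Eh.
apply/polyP => k; elim/ltn_ind: k => k IHk.
have [dk|kd] := ltnP (d./2) k.
  by rewrite !nth_default // (leq_trans _ dk).
have := congr1 (fun q : {poly rat} => q`_k) Egh.
rewrite /gamma_expansion !coef_sum.
pose k' := Ordinal (kd : (k < (d./2).+1)%N).
rewrite (bigD1 k') //= [in RHS](bigD1 k') //= !coefZ.
have -> : ('X^k * (1 + 'X) ^+ (d - 2 * k) : {poly rat})`_k = 1.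
  by rewrite coefXnM ltnn subnn -horner_coef0 !hornerE expr1n.
rewrite !mulr1; set sg' := \sum_(i < _ | _) _; set sh' := \sum_(i < _ | _) _.
suff -> : sg' = sh' by apply: addIr.
apply: eq_bigr => i ik; rewrite !coefZ.
have [ltik|] := ltnP i k; first by rewrite IHk.
rewrite leq_eqVlt => /orP[/eqP Eik|ltki].
  by case/eqP: ik; apply: val_inj.
by rewrite coefXnM ltki !mulr0.
Qed.

(* Main.v *)
(* An Abelian Dyck path of semilength m is determined by the word E u E with
   u of length m - 1 free, and its peaks are one more than the factors NE of
   E u E.  Reading u letter by letter gives Peak(t)/t = U_m(1, t), where
   U_n(a, b) is the rational part of (a + sqrt b)^n.  Since
   (1 + sqrt t)^2 = (1 + t) + sqrt (4 t), this is U_n(1 + t, 4 t) for m = 2n,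
   whose expansion in powers of 1 + t has the coefficients of U_n(1, 4 t) as
   gamma-coefficients.  Reading E u E two letters at a time, the avoidance
   condition forces the middle letter of a block S_{2j-1} S_{2j} S_{2j+1} with
   equal ends and leaves it free otherwise, so that the avoiding words are
   counted by U_n(1, 4 t) as well. *)

Require Import Defs.
From HB Require Import structures.
From mathcomp Require Import all_boot all_order all_algebra.
From mathcomp Require Import zify ring.

Set Implicit Arguments.
Unset Strict Implicit.
Unset Printing Implicit Defensive.

Import Order.TTheory GRing.Theory Num.Theory.
Local Open Scope ring_scope.

(** * Binomial sums *)

(* The pair (U, V) with (a + s)^n = U + V s, where s is a square root of b. *)
Fixpoint sqrt_pow (R : comNzRingType) (a b : R) (n : nat) : R * R :=
  if n is n'.+1 then
    let: (u, v) := sqrt_pow a b n' in (a * u + b * v, a * v + u)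
  else (1, 0).

Lemma sqrt_powS (R : comNzRingType) (a b : R) n :
  sqrt_pow a b n.+1 =
  (a * (sqrt_pow a b n).1 + b * (sqrt_pow a b n).2,
   a * (sqrt_pow a b n).2 + (sqrt_pow a b n).1).
Proof. by rewrite /=; case: (sqrt_pow a b n). Qed.

(** For [n < k] truncated subtraction spoils the exponents, but the binomial coefficient then
    vanishes. *)
Lemma exprS_subn (R : comNzRingType) (a : R) n k :
  a ^+ (n.+1 - k) *+ 'C(n, k) = a * (a ^+ (n - k) *+ 'C(n, k)).
Proof.
have [kn|nk] := leqP k n; first by rewrite subSn // exprS mulrnAr.
by rewrite bin_small // !mulr0n mulr0.
Qed.

Lemma sqrt_pow_sum (R : comNzRingType) (a b : R) n :
  (forall N, (n < 2 * N)%N ->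
     (sqrt_pow a b n).1 =
       \sum_(r < N) a ^+ (n - 2 * r) * b ^+ r *+ 'C(n, 2 * r)) /\
  (forall N, (n <= 2 * N)%N ->
     (sqrt_pow a b n).2 =
       \sum_(r < N) a ^+ (n - (2 * r).+1) * b ^+ r *+ 'C(n, (2 * r).+1)).
Proof.
elim: n => [|n [IHu IHv]].
  split=> [[|N] // _|N _] /=.
    by rewrite big_ord_recl big1 ?addr0 ?expr0 ?mulr1.
  by rewrite big1.
rewrite sqrt_powS /=; split=> [[|N] // ltnN | N lenN].
  rewrite (IHu N.+1); last by lia.
  rewrite (IHv N); last by lia.
  rewrite !big_ord_recl /= !muln0 !subn0 !bin0 !expr0 !mulr1 !mulr1n.
  rewrite mulrDr -exprS -addrA; congr (_ + _).
  rewrite !mulr_sumr -big_split /=; apply: eq_bigr => r _.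
  have -> : (2 * bump 0 r = (2 * r).+2)%N by rewrite /bump; lia.
  rewrite binS mulrnDr -[in RHS]mulrnAl exprS_subn; congr (_ + _).
    by rewrite -mulrA mulrnAl.
  by rewrite subSS exprS mulrnAr; congr (_ *+ _); ring.
rewrite (IHv N); last by lia.
rewrite (IHu N) // mulr_sumr -big_split /=; apply: eq_bigr => r _.
rewrite binS mulrnDr -[in RHS]mulrnAl exprS_subn; congr (_ + _).
by rewrite -mulrA mulrnAl.
Qed.

Lemma sqrt_pow_conj (R : comNzRingType) (a b s : R) n : s ^+ 2 = b ->
  (a + s) ^+ n = (sqrt_pow a b n).1 + s * (sqrt_pow a b n).2.
Proof.
move=> <-; elim: n => [|n IHn]; first by rewrite mulr0 addr0.
by rewrite exprS IHn sqrt_powS /=; ring.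
Qed.

(* (1 + s)^2 = (1 + t) + 2s when s^2 = t. *)
Lemma sqrt_pow_double (R : comNzRingType) (t : R) n :
  (sqrt_pow 1 t (2 * n)).1 = (sqrt_pow (1 + t) (4 * t) n).1 /\
  (sqrt_pow 1 t (2 * n)).2 = 2 * (sqrt_pow (1 + t) (4 * t) n).2.
Proof.
elim: n => [|n [IHu IHv]]; first by rewrite /= mulr0.
have -> : (2 * n.+1 = (2 * n).+2)%N by lia.
by rewrite !sqrt_powS /= IHu IHv; split; ring.
Qed.

(** * Words *)

(** A list built letter by letter, so that sums over it split along the first letter. *)
Fixpoint words (l : nat) : seq (seq step) :=
  if l is l'.+1 then map (cons East) (words l') ++ map (cons North) (words l')
  else [:: [::]].

Lemma mem_words l u : (u \in words l) = (size u == l).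
Proof.
elim: l u => [|l IHl] [|b u] //=.
  by rewrite mem_cat; apply/negbTE/norP; split; apply/mapP => -[].
have cons_inj (c : step) : injective (cons c) by move=> ? ? [].
have cons_ne (c d : step) s r : c != d -> (c :: s \in map (cons d) r) = false.
  by move=> cd; apply/mapP => -[v _ [ecd _]]; rewrite ecd eqxx in cd.
rewrite mem_cat eqSS -IHl; case: b.
  by rewrite mem_map // cons_ne.
by rewrite mem_map // [in X in _ || X]cons_ne // orbF.
Qed.

Lemma uniq_words l : uniq (words l).
Proof.
elim: l => //= l IHl.
have cons_inj (c : step) : injective (cons c) by move=> ? ? [].
rewrite cat_uniq !map_inj_uniq // IHl /= andbT.
by apply/hasPn => _ /mapP[u _ ->]; apply/mapP => -[v _ []].
Qed.

Lemma big_words (R : nmodType) l (P : pred (seq step)) (F : seq step -> R) :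
  \sum_(u <- words l.+1 | P u) F u =
  \sum_(u <- words l | P (East :: u)) F (East :: u) +
  \sum_(u <- words l | P (North :: u)) F (North :: u).
Proof. by rewrite /= big_cat /= !big_map. Qed.

Lemma path_peaks_cons2 b c w :
  path_peaks (b :: c :: w) = (((b, c) == (North, East)) + path_peaks (c :: w))%N.
Proof. by []. Qed.

(** Prefixing a letter creates a peak only for [North] before [East]. Split by the first letter, the
    sums satisfy $E' = E + N$ and $N' = tE + N$, the recurrence of $(U, tV)$ for $a = 1$, $b =
    t$. *)
Lemma sum_words_peaks (R : comNzRingType) (t : R) l :
  \sum_(u <- words l) t ^+ path_peaks (East :: rcons u East) =
    (sqrt_pow 1 t l.+1).1 /\
  \sum_(u <- words l) t ^+ path_peaks (North :: rcons u East) =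
    t * (sqrt_pow 1 t l.+1).2.
Proof.
elim: l => [|l [IHE IHN]].
  by rewrite /= !big_seq1 /= !mulr0 !mulr1 addr0 add0r mulr1 expr0 expr1.
split; rewrite big_words sqrt_powS /=.
  rewrite -/(sqrt_pow 1 t l.+1) !mul1r -IHE -IHN; congr (_ + _).
rewrite mul1r mulrDr -IHE -IHN addrC.
congr (_ + _); rewrite mulr_sumr; apply: eq_bigr => u _.
by rewrite path_peaks_cons2 exprS.
Qed.

(** Consecutive blocks share a letter: [d] ends the first block and begins the next. *)
Lemma avoids_cons3 j b c d u :
  avoids_ENE_NEN j.+1 [:: b, c, d & u] =
  ([:: b; c; d] \notin [:: [:: East; North; East]; [:: North; East; North]])
  && avoids_ENE_NEN j (d :: u).
Proof.
apply/forallP/andP => [av|[av0 /forallP av] [[|i] lti]].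
- split; first by have := av ord0; rewrite muln0 /= take0.
  apply/forallP => i; have := av (lift ord0 i).
  by have -> : (2 * lift ord0 i = (2 * i).+2)%N by rewrite lift0; lia.
- by rewrite /= take0.
have := av (Ordinal (lti : (i < j)%N)).
by rewrite [nat_of_ord (@Ordinal _ i.+1 _)]/= mulnS.
Qed.

Lemma avoids1 b c :
  avoids_ENE_NEN 1 [:: b; c] =
  ([:: b; c; East] \notin [:: [:: East; North; East]; [:: North; East; North]]).
Proof.
apply/forallP/idP => [/(_ ord0) //|av i].
by rewrite ord1.
Qed.

Lemma sum_avoids_cons3 (R : comNzRingType) (t : R) r j b c d :
  \sum_(u <- r | avoids_ENE_NEN j.+1 [:: b, c, d & u])
     t ^+ path_peaks [:: b, c, d & rcons u East] =
  if [:: b; c; d] \in [:: [:: East; North; East]; [:: North; East; North]] then 0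
  else t ^+ path_peaks [:: b; c; d] *
       \sum_(u <- r | avoids_ENE_NEN j (d :: u))
          t ^+ path_peaks (d :: rcons u East).
Proof.
under eq_bigl do rewrite avoids_cons3.
case: ifP => _; first by rewrite big_pred0.
rewrite mulr_sumr; apply: eq_bigr => u _.
by rewrite -exprD !path_peaks_cons2 addn0 addnA.
Qed.

(** Each block is a transfer step. Equal ends leave one middle letter, of weight $1$; from [East] to
    [North] both middles are free of peaks, weight $2$; from [North] to [East] both give one peak,
    weight $2t$. Hence $E' = E + 2N$ and $N' = 2tE + N$, solved by $(U, 2tV)$ with $b = 4t$. *)
Lemma sum_words_avoiding (R : comNzRingType) (t : R) j :
  \sum_(u <- words (2 * j).+1 | avoids_ENE_NEN j.+1 (East :: u))
     t ^+ path_peaks (East :: rcons u East) = (sqrt_pow 1 (4 * t) j.+1).1 /\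
  \sum_(u <- words (2 * j).+1 | avoids_ENE_NEN j.+1 (North :: u))
     t ^+ path_peaks (North :: rcons u East) = 2 * t * (sqrt_pow 1 (4 * t) j.+1).2.
Proof.
elim: j => [|j [IHE IHN]].
  rewrite muln0 !big_words /= !big_cons !big_nil !avoids1 /=.
  by rewrite !expr0 !expr1; split; ring.
have -> : (2 * j.+1).+1 = ((2 * j).+1).+2 by lia.
rewrite (sqrt_powS _ _ j.+1); case: (sqrt_pow _ _ _) IHE IHN => x y /= IHE IHN.
rewrite ![\sum_(u <- words (2 * j).+3 | _) _]big_words !(big_words (2 * j).+1) /=.
by rewrite !sum_avoids_cons3 IHE IHN /= !expr0 !expr1; split; ring.
Qed.


Local Close Scope ring_scope.

(** * Dyck paths and area sequences *)

Fixpoint abscissae (e : nat) (w : seq step) : seq nat :=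
  match w with
  | [::] => [::]
  | North :: w' => e :: abscissae e w'
  | East :: w' => abscissae e.+1 w'
  end.

(* Exchanges the area sequence (a_i) with the abscissae (i - 1 - a_i) of the
   North steps. *)
Definition flip_area (s : seq nat) : seq nat :=
  mkseq (fun i => i - nth 0 s i) (size s).

Lemma area_of_pathE w : area_of_path w = flip_area (abscissae 0 w).
Proof.
(* For the induction the word is preceded by [n] North and [e] East steps. *)
suff gen n e : [seq (n + num_N (take p w)) - (e + num_E (take p w))
      | p <- iota 0 (size w) & nth East w p == North] =
    mkseq (fun i => (n + i) - nth 0 (abscissae e w) i) (size (abscissae e w)).
  exact: (gen 0 0).
elim: w n e => [|b w IHw] n e //=.
rewrite -[1]addn0 iotaDl filter_map.
rewrite (eq_filter (a2 := fun p => nth East w p == North)) //.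
case: b => /=.
  rewrite -map_comp /mkseq /= -[1]addn0 iotaDl -map_comp !addn0; congr (_ :: _).
  transitivity ([seq (n.+1 + num_N (take p w)) - (e + num_E (take p w))
      | p <- iota 0 (size w) & nth East w p == North]).
    by apply: eq_map => p /=; rewrite !add0n; lia.
  by rewrite IHw; apply: eq_map => p /=; rewrite addnS.
rewrite -map_comp -IHw.
by apply: eq_map => p /=; rewrite !add0n; lia.
Qed.

Lemma nth_flip_area s i : i < size s -> nth 0 (flip_area s) i = i - nth 0 s i.
Proof. by move=> lti; rewrite nth_mkseq. Qed.

Lemma size_flip_area s : size (flip_area s) = size s.
Proof. by rewrite size_mkseq. Qed.

(** The bound keeps the truncated subtraction exact. *)
Lemma flip_areaK s : (forall i, i < size s -> nth 0 s i <= i) ->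
  flip_area (flip_area s) = s.
Proof.
move=> les; apply: (@eq_from_nth _ 0); rewrite !size_flip_area // => i lti.
by rewrite !nth_flip_area ?size_flip_area // subKn ?les.
Qed.

Lemma abscissae_cat e v w :
  abscissae e (v ++ w) = abscissae e v ++ abscissae (e + num_E v) w.
Proof.
elim: v e => [|[] v IHv] e; rewrite /num_E /= ?addn0 //.
  by rewrite IHv.
by rewrite IHv addSnnS.
Qed.

Lemma abscissae_North e k : abscissae e (nseq k North) = nseq k e.
Proof. by elim: k => //= k ->. Qed.

Lemma abscissae_East e k : abscissae e (nseq k East) = [::].
Proof. by elim: k e => /=. Qed.

Lemma size_abscissae e w : size (abscissae e w) = num_N w.
Proof. by elim: w e => [|[] w IHw] e //=; rewrite IHw. Qed.

Lemma path_abscissae e w : path leq e (abscissae e w).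
Proof.
elim: w e => [|[] w IHw] e //=; first by rewrite leqnn IHw.
by case: (abscissae _ _) (IHw e.+1) => //= y s /andP[/ltnW-> ->].
Qed.

Lemma abscissae_le e w : all (fun y => y <= e + num_E w) (abscissae e w).
Proof.
elim: w e => [|[] w IHw] e //=; first by rewrite leq_addr IHw.
by apply: sub_all (IHw e.+1) => y; rewrite /num_E /= addSnnS.
Qed.

Lemma abscissae_ge e w : all (leq e) (abscissae e w).
Proof. exact: order_path_min leq_trans (path_abscissae e w). Qed.

(** An initial [North] records [e], while after an initial [East] only larger values occur, so first
    letters agree. The East steps after the last North leave no trace; the hypothesis on [num_E]
    fixes their number. *)
Lemma abscissae_inj e v w : num_E v = num_E w ->
  abscissae e v = abscissae e w -> v = w.
Proof.
have clash e1 u1 u2 : abscissae e1.+1 u1 <> e1 :: abscissae e1 u2.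
  by have := abscissae_ge e1.+1 u1; case: abscissae => //= y s /andP[? _] []; lia.
elim: v e w => [|[] v IHv] e [|[] w] //=; rewrite /num_E /=.
- by move=> Evw [/IHv->].
- by move=> _ /esym/clash.
- by move=> _ /clash.
by move=> [Evw] /IHv->.
Qed.

(** Each increment of [s] becomes a run of East steps before the next North; what remains of the [b]
    East steps goes to the end. *)
Lemma abscissae_onto e b s : path leq e s -> all (fun y => y <= e + b) s ->
  exists2 w, abscissae e w = s & num_E w = b.
Proof.
elim: s e b => [|y s IHs] e b /=.
  by exists (nseq b East); rewrite ?abscissae_East // /num_E count_nseq mul1n.
move=> /andP[ley ps] /andP[yb les].
have [||w ws wb] := IHs y (e + b - y); [done | |].
  by apply: sub_all les => z; lia.
exists (nseq (y - e) East ++ North :: w).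
  rewrite abscissae_cat abscissae_East /num_E count_nseq mul1n /=.
  by rewrite subnKC // ws.
by rewrite /num_E count_cat count_nseq /= mul1n -/(num_E w) wb; lia.
Qed.

(** Strict ascents, the last entry being counted as if a larger one followed. *)
Fixpoint rises (s : seq nat) : nat :=
  if s is y :: s' then (if s' is z :: _ then y < z else true) + rises s' else 0.

Lemma rises_sum s :
  rises s =
  \sum_(i <- iota 0 (size s)) ((i.+1 == size s) || (nth 0 s i < nth 0 s i.+1)).
Proof.
elim: s => [|y s IHs]; first by rewrite big_nil.
rewrite [size _]/= [iota _ _]/= big_cons -[1]addn0 iotaDl big_map.
rewrite [LHS]/= IHs; congr (_ + _).
by case: s {IHs}.
Qed.

(** A North step is followed by an East step exactly when the next abscissa is larger or no North
    step is left; the appended [East] covers the latter case. *)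
Lemma rises_abscissae e w :
  rises (abscissae e w) = path_peaks (East :: rcons w East) /\
  rises (e :: abscissae e w) = path_peaks (North :: rcons w East).
Proof.
elim: w e => [|[] w IHw] e //=.
  have [_ IHN] := IHw e; rewrite !path_peaks_cons2 /= in IHN *.
  by rewrite -IHN /= ltnn.
have [IHE _] := IHw e.+1; rewrite !path_peaks_cons2 -IHE /=; split => //.
by have := abscissae_ge e.+1 w; case: (abscissae _ _) => //= z s /andP[-> _].
Qed.

(** * The paths (k, L) *)

(* The path (k, L) with L = East :: u. *)
Definition kL_path (u : seq step) : seq step :=
  nseq (num_E u).+1 North ++ (East :: u) ++ nseq (num_N u) East.

Lemma num_NE u : num_N u + num_E u = size u.
Proof. by elim: u => [|[] u IHu] //=; rewrite -IHu /num_N /num_E /=; lia. Qed.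

Lemma size_kL_path u : size (kL_path u) = (size u).+1 + (size u).+1.
Proof. by rewrite !size_cat !size_nseq /= -num_NE; lia. Qed.

Lemma num_N_kL_path u : num_N (kL_path u) = (size u).+1.
Proof.
rewrite /num_N !count_cat !count_nseq /= -/(num_N u) -num_NE; lia.
Qed.

Lemma num_E_kL_path u : num_E (kL_path u) = (size u).+1.
Proof.
rewrite /num_E !count_cat !count_nseq /= -/(num_E u) -num_NE; lia.
Qed.

(** A prefix inside the initial run has no East step; one ending inside $L$ has at most $k$, the
    length of that run; a longer one already contains all North steps. *)
Lemma dyck_kL_path u : dyck (size u).+1 (kL_path u).
Proof.
rewrite /dyck /endpoint num_E_kL_path num_N_kL_path eqxx andTb.
apply/allP => l _; rewrite /num_E /num_N.
have count_take_le (c : step) i (w : seq step) :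
    count_mem c (take i w) <= count_mem c w.
  exact: leq_count_subseq (take_subseq _ _).
have [lk|kl] := ltnP l (num_E u).+1.
  rewrite take_cat size_nseq lk take_nseq; last exact: ltnW.
  by rewrite !count_nseq.
have [lk|{}kl] := ltnP (l - (num_E u).+1) (size u).+1.
  rewrite take_cat size_nseq ltnNge kl -[~~ true]/false take_cat -[size _]/(size u).+1 lk.
  have := count_take_le East (l - (num_E u).+1) (East :: u).
  rewrite !count_cat !count_nseq -[count_mem East (East :: u)]/(num_E u).+1 /= ; lia.
have := count_take_le East l (kL_path u).
rewrite -/(num_E (kL_path u)) num_E_kL_path => /leq_trans; apply.
rewrite /kL_path catA take_cat size_cat size_nseq [size (_ :: _)]/=.
case: (ltnP l) => [|_]; first lia.
rewrite !count_cat count_nseq /= -/(num_N u) -num_NE; lia.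
Qed.

Lemma abscissae_kL_path u :
  abscissae 0 (kL_path u) = nseq (num_E u).+1 0 ++ abscissae 1 u.
Proof.
rewrite /kL_path !abscissae_cat abscissae_North abscissae_East cats0.
by rewrite {2}/num_E count_nseq.
Qed.

(** The first $k$ abscissae vanish, and the others are at most $k$, hence at most their index. *)
Lemma nth_abscissae_kL_path_le u i : nth 0 (abscissae 0 (kL_path u)) i <= i.
Proof.
rewrite abscissae_kL_path nth_cat size_nseq nth_nseq; case: ltnP => // lti.
have [lt2|?] := ltnP (i - (num_E u).+1) (size (abscissae 1 u)); last first.
  by rewrite nth_default.
have /allP/(_ _ (mem_nth 0 lt2)) := abscissae_le 1 u; rewrite /=; lia.
Qed.

(** As $L$ begins with [East], exactly $k$ abscissae are zero. So $k$ is recovered, and with it the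
    number of East steps of [u]. *)
Lemma area_kL_path_inj : injective (area_of_path \o kL_path).
Proof.
move=> u v; rewrite /= !area_of_pathE => /(congr1 flip_area).
rewrite !flip_areaK; try by move=> i _; apply: nth_abscissae_kL_path_le.
rewrite !abscissae_kL_path => Euv.
have zeros w : count_mem 0 (abscissae 1 w) = 0.
  by apply/count_memPn/negP => /(allP (abscissae_ge 1 w)).
have /eqP := congr1 (count_mem 0) Euv.
rewrite !count_cat !zeros !count_nseq !addn0 !mul1n eqSS => /eqP Ek.
move: Euv; rewrite Ek => /(congr1 (drop (num_E v).+1)).
by rewrite !drop_size_cat ?size_nseq //; apply: abscissae_inj.
Qed.

Lemma path_peaks_North k w :
  path_peaks (nseq k.+1 North ++ East :: w) = (path_peaks (East :: w)).+1.
Proof. by elim: k => //= k IHk; rewrite path_peaks_cons2 IHk. Qed.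

Lemma path_peaks_East b w j :
  path_peaks (b :: w ++ nseq j.+1 East) = path_peaks (b :: rcons w East).
Proof.
elim: w b => [|c w IHw] b /=; last by rewrite !path_peaks_cons2 IHw.
rewrite !path_peaks_cons2; congr (_ + _).
by elim: j => //= j IHj; rewrite path_peaks_cons2 IHj.
Qed.

Lemma path_peaks_kL_path u :
  path_peaks (kL_path u) = (path_peaks (East :: rcons u East)).+1.
Proof.
rewrite /kL_path (path_peaks_North _ (u ++ _)); congr _.+1.
case E: (num_N u) => [|j]; last by rewrite path_peaks_East.
(* Without trailing East steps [u] is all East, so the appended [East] creates no peak. *)
rewrite cats0; have /all_pred1P -> : all (pred1 East) u.
  move: E; rewrite /num_N => /count_memPn nu.
  by apply/allP => -[] // /(negP nu).
by elim: (size u) => //= r IHr; rewrite !path_peaks_cons2 -IHr.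
Qed.

(** * Abelian area sequences and their peak-edges *)

Lemma entry_flip_area x i : 0 < i <= size x ->
  entry (flip_area x) i = i.-1 - nth 0 x i.-1.
Proof. by case: i => // i /andP[_ lti]; rewrite /entry nth_flip_area. Qed.

Lemma area_seqP m a : reflect
  [/\ size a = m, forall i, i < m -> nth 0 a i <= i &
      forall i, i.+1 < m -> nth 0 a i.+1 <= (nth 0 a i).+1]
  (area_seq m a).
Proof.
apply: (iffP and3P) => [[/eqP sz /allP lta /allP lea]|[sz lta lea]].
  split=> // i ltim.
    by have := lta i.+1; rewrite mem_iota /entry /=; lia.
  by have := lea i.+2; rewrite mem_iota /entry /=; lia.
split; first exact/eqP.
  apply/allP => -[|i]; rewrite mem_iota //= => ltim.
  by rewrite /entry ltnS lta //; lia.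
by apply/allP => -[|[|i]]; rewrite mem_iota //= => ltim; apply: lea; lia.
Qed.

(** Vertices $2,\dots,k$ have abscissa $0$ and are adjacent to $1$. The last abscissa is at most
    $k$, so every vertex beyond $k$ other than the last is adjacent to the last one. *)
Lemma area_kL_path_abelian u :
  area_seq (size u).+1 (area_of_path (kL_path u)) &&
  abelian_seq (area_of_path (kL_path u)).
Proof.
rewrite area_of_pathE; set x := abscissae 0 (kL_path u).
have szx : size x = (size u).+1 by rewrite size_abscissae num_N_kL_path.
have xS i : i.+1 < size x -> nth 0 x i <= nth 0 x i.+1.
  have /(path_sorted)/sortedP := path_abscissae 0 (kL_path u); exact.
have xle := nth_abscissae_kL_path_le u; rewrite -/x in xle.
have [k [k0 xk0 xk]] : exists k, [/\ 0 < k, forall i, i < k -> nth 0 x i = 0 &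
    forall i, nth 0 x i <= k].
  exists (num_E u).+1; split=> // i.
    by rewrite /x abscissae_kL_path nth_cat size_nseq nth_nseq => ->.
  have [lti|?] := ltnP i (size x); last by rewrite nth_default.
  have /allP/(_ _ (mem_nth 0 lti)) := abscissae_le 0 (kL_path u).
  rewrite /x abscissae_kL_path nth_cat size_nseq nth_nseq.
  have [//|lek] := ltnP i (num_E u).+1.
  have [lt2|?] := ltnP (i - (num_E u).+1) (size (abscissae 1 u)); last first.
    by rewrite nth_default.
  by have /allP/(_ _ (mem_nth 0 lt2)) := abscissae_le 1 u.
clearbody x.
apply/andP; split.
  apply/area_seqP; rewrite size_flip_area szx; split=> // i lti.
    by rewrite nth_flip_area ?szx // leq_subr.
  have := xS i; rewrite !nth_flip_area ?szx //; last exact: ltnW.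
  by move=> /(_ lti); lia.
apply/allP => i; rewrite mem_iota size_flip_area => /andP[i0 im].
rewrite /adjacent /edge !size_flip_area !entry_flip_area ?szx //; try lia.
have [lik|ki] := leqP i k.
  have := xk0 i.-1; lia.
have := xk (size u); have := xle (size u); rewrite /=; lia.
Qed.

Lemma abelian_area_onto m a : area_seq m.+1 a -> abelian_seq a ->
  exists2 u, size u = m & area_of_path (kL_path u) = a.
Proof.
move=> /area_seqP[sza lea leaS] /allP abl.
pose x := flip_area a; have szx : size x = m.+1 by rewrite size_flip_area.
have xE i : i < m.+1 -> nth 0 x i = i - nth 0 a i.
  by move=> lti; rewrite nth_flip_area ?sza.
have srt : sorted leq x.
  apply/(sortedP 0) => i; rewrite szx => lti; rewrite !xE //; last exact: ltnW.
  have := leaS i lti; lia.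
have mono i j : i <= j -> j < m.+1 -> nth 0 x i <= nth 0 x j.
  move=> leij ltj; apply: (sorted_leq_nth leq_trans leqnn) => //.
    by rewrite inE szx; lia.
  by rewrite inE szx.
(* [k] is the number of leading zero abscissae. *)
pose k := find (fun y => 0 < y) x.
have km : k <= m.+1 by rewrite -szx find_size.
have xk i : i < k -> nth 0 x i = 0.
  by move=> /(before_find 0); case: (nth 0 x i).
have k0 : 0 < k.
  rewrite /k; move: (xE 0 isT) szx; case: {+}x => //= y s.
  by rewrite sub0n => ->.
(* Vertex [k.+1] has positive abscissa, so it is not adjacent to $1$; unless it is the last vertex,
   it must be adjacent to the last, which is this bound. *)
have xkle : k < m.+1 -> nth 0 x m <= k.
  move=> ltk; have xkk : 0 < nth 0 x k.
    by rewrite (nth_find 0) // has_find szx.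
  have [->|nekm] := eqVneq k m; first by rewrite xE // leq_subr.
  have := abl k.+1; rewrite mem_iota sza => /(_ ltac:(lia)).
  rewrite /adjacent /edge sza /entry /=.
  have := lea k ltk; have := lea m (leqnn _).
  rewrite !xE // in xkk *; lia.
have xdrop : take k x = nseq k 0.
  apply: (@eq_from_nth _ 0); rewrite size_takel ?szx // ?size_nseq // => i lti.
  by rewrite nth_take // nth_nseq lti xk.
have nthd i : nth 0 (drop k x) i = nth 0 x (k + i) by rewrite nth_drop.
have szd : size (drop k x) = m.+1 - k by rewrite size_drop szx.
(* The positive abscissae lie between $1$ and $k$: the head of $L$ brings the path to abscissa $1$,
   which leaves $k-1$ East steps for [u]. *)
have [||u us uk] := @abscissae_onto 1 k.-1 (drop k x).
- rewrite path_sortedE; last exact: leq_trans.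
  rewrite (drop_sorted k srt) andbT; apply/(all_nthP 0) => i; rewrite szd nthd => lti.
  have ltk : k < m.+1 by lia.
  apply: (leq_trans (n := nth 0 x k)); first by rewrite (nth_find 0) // has_find szx.
  by apply: mono; lia.
- apply/(all_nthP 0) => i; rewrite szd nthd => lti.
  apply: (leq_trans (n := nth 0 x m)); first by apply: mono; lia.
  by rewrite add1n prednK //; apply: xkle; lia.
exists u.
  by rewrite -num_NE -(size_abscissae 1) us uk szd; lia.
rewrite area_of_pathE abscissae_kL_path us uk prednK // -xdrop cat_take_drop.
by rewrite flip_areaK // sza.
Qed.

(* With X j = j - a_j, an edge {X j, j} or an isolated vertex X j = j is a
   peak-edge exactly when X j < X (j + 1) or j = m, and each peak-edge has this
   form for one j. *)
Lemma peak_rises m a : area_seq m a -> peak a = rises (flip_area a).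
Proof.
move=> /area_seqP[sza lea leaS]; pose X i := i - entry a i.
have X_le i : X i <= i by apply: leq_subr.
have X0 i : 0 < i <= m -> 0 < X i.
  case: i => // i /andP[_ /lea]; rewrite /X /entry /=; lia.
have XS i : 0 < i < m -> X i <= X i.+1.
  case: i => // i /andP[_ lti]; have := leaS i lti; rewrite /X /entry /=; lia.
have X_mono i j : 0 < i -> i <= j <= m -> X i <= X j.
  move=> i0; elim: j => [|j IHj]; first lia.
  rewrite leq_eqVlt => /andP[/orP[/eqP-> //|lti] ltj].
  apply: leq_trans (IHj _) (XS j _); lia.
pose top j := (j == m) || (X j < X j.+1).
have isolatedE j : 0 < j <= m -> isolated a j = (X j == j) && top j.
  move=> jm; apply/idP/idP.
    move=> /allP iso.
    have iso1 i : 0 < i <= m -> ~~ adjacent a j i.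
      by move=> im; apply: iso; rewrite mem_iota sza; lia.
    (* Being non-adjacent to $j-1$ forces $X_j = j$, and to $j+1$ forces $X_{j+1} > j$. *)
    have := iso1 j.-1; have := iso1 j.+1; have := X0 j jm; have := X_le j.
    by rewrite /adjacent /edge sza -!/(X _) /top; lia.
  move=> /andP[/eqP Xj topj]; apply/allP => i; rewrite mem_iota sza => im.
  rewrite /adjacent /edge sza -!/(X _) Xj.
  have [lt_ij|lt_ji|->] := ltngtP i j; [lia| |lia].
  have := X_mono j.+1 i isT; rewrite /top in topj; lia.
have properE i j : 0 < i -> 0 < j <= m ->
    proper_peak_edge a i j = (i == X j) && ((X j < j) && top j).
  move=> i0 jm; have := X0 j jm.
  by rewrite /proper_peak_edge /edge sza -!/(X _) /top; lia.
have -> : rises (flip_area a) = \sum_(j <- iota 1 m) top j.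
  rewrite rises_sum size_flip_area sza -[1]addn0 iotaDl big_map.
  apply: eq_big_seq => i; rewrite mem_iota /= => lti.
  rewrite /top add1n; case: eqP => //= nei; congr (nat_of_bool _).
  rewrite !nth_flip_area ?sza //; last lia.
  have := lea i lti; have := lea i.+1; rewrite /X /entry /=; lia.
(* Grouped by the larger endpoint [j], only [i = X j] can contribute; the cases [X j = j] (isolated
   vertex) and [X j < j] (proper edge) exclude each other. *)
rewrite /peak sza -!sum1_count big_mkcond [X in _ + X]big_mkcond big_allpairs.
rewrite exchange_big -big_split; apply: eq_big_seq => j.
rewrite mem_iota add1n ltnS /= => jm.
have Xjm : X j \in iota 1 m by rewrite mem_iota; have := X0 j jm; have := X_le j; lia.
rewrite isolatedE // (bigD1_seq (X j)) ?iota_uniq //= big_seq_cond big1 => [|i].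
  rewrite properE ?eqxx ?X0 //; have := X_le j; case: ltngtP => //= _ _;
  by case: (top j).
rewrite mem_iota => /andP[/andP[i0 _] neX].
by rewrite properE // (negbTE neX).
Qed.

Lemma peak_area_kL_path u : peak (area_of_path (kL_path u)) =
  (path_peaks (East :: rcons u East)).+1.
Proof.
have /andP[aa _] := area_kL_path_abelian u.
rewrite (peak_rises aa) area_of_pathE flip_areaK; last first.
  by move=> i _; apply: nth_abscissae_kL_path_le.
(* The trailing East steps carry no abscissa and can be cut off. *)
have -> : abscissae 0 (kL_path u) =
    abscissae 0 (nseq (num_E u).+1 North ++ East :: u).
  by rewrite abscissae_kL_path abscissae_cat abscissae_North /num_E count_nseq.
rewrite (rises_abscissae 0 _).1 rcons_cat.
by rewrite -(path_peaks_North (num_E u)).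
Qed.

(** * From sets of tuples to lists of words *)

(** Both index families embed without repetition in a common type [S], where they have the same
    image. *)
Lemma big_set_reindex (R : nmodType) (T : finType) (S : eqType) (W : Type)
    (A : {set T}) (r : seq W) (f : T -> S) (g : W -> S) (F : S -> R) :
  injective f -> uniq (map g r) ->
  (forall s, (exists2 a, a \in A & f a = s) <-> s \in map g r) ->
  (\sum_(a in A) F (f a) = \sum_(w <- r) F (g w))%R.
Proof.
move=> injf uniqg Ag.
rewrite -big_enum /= -(big_map f predT F) -(big_map g predT F).
apply/perm_big/uniq_perm => //; first by rewrite map_inj_uniq // enum_uniq.
move=> s; apply/mapP/idP => [[a aA ->]|/Ag[a aA <-]].
  by apply/Ag; exists a; rewrite // -mem_enum.
by exists a; rewrite // mem_enum.
Qed.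

Local Open Scope ring_scope.

Lemma Peak_poly_words m :
  Peak_poly m.+1 = 'X * \sum_(u <- words m) 'X^(path_peaks (East :: rcons u East)).
Proof.
rewrite mulr_sumr.
under eq_bigr do rewrite -exprS -peak_area_kL_path.
rewrite /Peak_poly.
apply: (big_set_reindex (f := fun a : m.+1.-tuple 'I_m.+1 => map val a)
  (g := area_of_path \o kL_path) (fun s => 'X^(peak s))).
- by move=> a b /(inj_map val_inj)/val_inj.
- by rewrite (map_inj_uniq area_kL_path_inj) uniq_words.
move=> s; split=> [[a]|/mapP[u]].
  rewrite inE => /andP[area_a abel_a] <-.
  have [u szu <-] := abelian_area_onto area_a abel_a.
  by apply: (map_f (area_of_path \o kL_path)); rewrite mem_words szu.
rewrite mem_words => /eqP szu -> /=.
have := area_kL_path_abelian u; rewrite szu.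
set a := area_of_path _ => a_ok.
have /andP[/area_seqP[sza lea _] _] := a_ok.
(* Each entry is at most its index, hence at most [m], so [inord] preserves it. *)
have Ea : map val (map (@inord m) a) = a.
  rewrite -map_comp -[RHS]map_id; apply/eq_in_map => y /(nthP 0%N)[i lti <-] /=.
  rewrite inordK // ltnS; rewrite sza in lti.
  exact: leq_trans (lea i lti) _.
have szt : size (map (@inord m) a) == m.+1 by rewrite size_map sza.
by exists (Tuple szt) => //; rewrite inE Ea.
Qed.

Lemma is_kL_kL_path m k L w : is_kL m k L w ->
  exists u, [/\ L = East :: u, (size u).+1 = m & w = kL_path u].
Proof.
move=> /and4P[_ /eqP[Ek Em] /eqP hd /eqP->]; case: L hd Ek Em => [|[] u] // _.
have -> : num_E (East :: u) = (num_E u).+1 by [].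
have -> : num_N (East :: u) = num_N u by [].
move=> <- <-; exists u; split=> //; first by rewrite -num_NE; lia.
by rewrite /kL_path; congr (_ ++ _ ++ nseq _ _); lia.
Qed.

Lemma kL_path_is_kL u : is_kL (size u).+1 (num_E u).+1 (East :: u) (kL_path u).
Proof.
apply/and4P; split=> //; first by rewrite -num_NE; lia.
  rewrite /endpoint -num_NE xpair_eqE.
  have -> : num_E (East :: u) = (num_E u).+1 by [].
  have -> : num_N (East :: u) = num_N u by [].
  by rewrite /=; lia.
by apply/eqP; rewrite /kL_path; congr (_ ++ _ ++ nseq _ _); rewrite -num_NE; lia.
Qed.

Lemma card_avoiding_abelian_dyck n r :
  #|avoiding_abelian_dyck n.+1 r.+1| =
  count (fun u => avoids_ENE_NEN n.+1 (East :: u) &&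
                  (path_peaks (East :: rcons u East) == r)) (words (2 * n).+1).
Proof.
have En : (2 * n.+1 = (2 * n).+2)%N by lia.
rewrite -sum1_card -sum1_count -[RHS]big_filter.
set ok := filter _ _.
apply: (@big_set_reindex nat _ _ _ _ ok
    (fun w : (2 * n.+1 + 2 * n.+1).-tuple step => val w)
  kL_path (fun=> 1%N)); first exact: val_inj.
  rewrite map_inj_uniq ?filter_uniq ?uniq_words // => u v Euv.
  by apply: area_kL_path_inj; rewrite /= Euv.
move=> s; split=> [[w]|/mapP[u]].
  rewrite inE => /and3P[_ pw /existsP[k /existsP[L /andP[kLw av]]]] <-.
  have [u [EL szu Ew]] := is_kL_kL_path kLw; rewrite [val w]Ew; apply: map_f.
  rewrite Ew path_peaks_kL_path eqSS EL in pw av.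
  by rewrite mem_filter av pw mem_words -eqSS szu En eqxx.
rewrite /ok mem_filter mem_words => /andP[/andP[av pk] /eqP szu] ->.
have szw : size (kL_path u) == (2 * n.+1 + 2 * n.+1)%N.
  by rewrite size_kL_path szu En.
have szL : size (East :: u) == (2 * n.+1)%N by rewrite /= szu En.
exists (Tuple szw) => //; rewrite inE; apply/and3P; split.
- rewrite /abelian_dyck [tval _]/(kL_path u) En -szu dyck_kL_path.
  by have /andP[_ ->] := area_kL_path_abelian u.
- by rewrite path_peaks_kL_path eqSS.
have ltk : ((num_E u).+1 < (2 * n.+1).+1)%N by rewrite En -szu -num_NE; lia.
apply/existsP; exists (Ordinal ltk); apply/existsP; exists (Tuple szL).
by rewrite /= av andbT En -szu kL_path_is_kL.
Qed.

(** * The gamma-polynomial, its closed form and its combinatorial meaning *)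

Theorem proposition4p12 (n : nat) (hn : (1 <= n)%N) :
  let gamma : {poly rat} :=
    \sum_(0 <= i < (n./2).+1) (2 ^ (2 * i) * 'C(n, 2 * i))%:R *: 'X^i in
  [/\ 'X %| Peak_poly (2 * n),
      is_gamma_poly (Peak_poly (2 * n) %/ 'X) gamma,
      (forall (C : numClosedFieldType) (t : C),
         (map_poly ratr gamma).[t] =
         ((1 + 2 * sqrtC t) ^+ n + (1 - 2 * sqrtC t) ^+ n) / 2) &
      (forall i : nat, (i <= n./2)%N ->
         #|avoiding_abelian_dyck n i.+1| = (2 ^ (2 * i) * 'C(n, 2 * i))%N)].
Proof.
move=> gamma.
have n_half : (n < 2 * (n./2).+1)%N by lia.
have gammaE : gamma = \poly_(i < (n./2).+1) (2 ^ (2 * i) * 'C(n, 2 * i))%:R.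
  by rewrite poly_def /gamma big_mkord.
(* Stated over any ring, for use both at a point of [C] and at ['X]. *)
have sqrt4 (R : comNzRingType) (t : R) : (sqrt_pow 1 (4 * t) n).1 =
    \sum_(i < (n./2).+1) (2 ^ (2 * i) * 'C(n, 2 * i))%:R * t ^+ i.
  rewrite (proj1 (sqrt_pow_sum _ _ n) _ n_half); apply: eq_bigr => i _.
  rewrite expr1n mul1r exprMn -mulrnAl expnM natrM natrX.
  by rewrite mulr_natr.
have Peak_poly_Q : Peak_poly (2 * n) = 'X * (sqrt_pow 1 'X (2 * n)).1.
  case: (n) hn => // n' _; have -> : (2 * n'.+1 = (2 * n').+2)%N by lia.
  by rewrite Peak_poly_words (sum_words_peaks _ _).1.
have QE :
  (sqrt_pow 1 'X (2 * n)).1 = \poly_(i < n.+1) 'C(2 * n, 2 * i)%:R :> {poly rat}.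
  rewrite (proj1 (sqrt_pow_sum _ _ _) n.+1) ?ltn_pmul2l // poly_def.
  apply: eq_bigr => i _.
  by rewrite expr1n mul1r scaler_nat.
have Peak_divX : Peak_poly (2 * n) %/ 'X = (sqrt_pow 1 'X (2 * n)).1.
  by rewrite Peak_poly_Q mulrC mulpK // polyX_eq0.
have degQ : degree (Peak_poly (2 * n) %/ 'X) = n.
  by rewrite Peak_divX QE /degree size_poly_eq //= binn.
split.
- by rewrite Peak_poly_Q dvdp_mulr.
- split.
  + rewrite /symmetric_poly degQ Peak_divX QE => t t0.
    (* Reversing the sum reduces symmetry to $\binom{2n}{2i}=\binom{2n}{2n-2i}$. *)
    rewrite !horner_poly (reindex_inj rev_ord_inj) mulr_sumr /=.
    apply: eq_bigr => i _; rewrite subSS mulnBr bin_sub ?leq_pmul2l ?leq_ord //.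
    rewrite mulrCA exprVn; congr (_ * _).
    by rewrite exprB ?leq_ord // unitfE.
  + by rewrite degQ gammaE size_poly.
  (* The binomial sum for $U_n(1+t, 4t)$ is already the gamma expansion. *)
  rewrite degQ Peak_divX (sqrt_pow_double _ _).1 (proj1 (sqrt_pow_sum _ _ n) _ n_half).
  apply: eq_bigr => i _; rewrite gammaE coef_poly ltn_ord.
  rewrite scaler_nat mulrnA expnM -[(2 ^ 2)%N]/4%N; congr (_ *+ _).
  by rewrite -[RHS]mulr_natl natrX exprMn mulrC [RHS]mulrA.
- move=> C t.
  have -> : (map_poly ratr gamma).[t] = (sqrt_pow 1 (4 * t) n).1.
    rewrite sqrt4 gammaE poly_def rmorph_sum horner_sum /=; apply: eq_bigr => i _.
    by rewrite map_polyZ map_polyXn !hornerE rmorph_nat.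
  have sq : (2 * sqrtC t) ^+ 2 = 4 * t by rewrite exprMn sqrtCK; ring.
  have sqN : (- (2 * sqrtC t)) ^+ 2 = 4 * t by rewrite sqrrN.
  (* The roots $\pm 2\sqrt t$ of $4t$ give $U \pm 2\sqrt t\,V$, whose half-sum is $U$. *)
  rewrite (sqrt_pow_conj _ _ sq) (sqrt_pow_conj _ _ sqN).
  by field.
move=> i lei.
have gamma_sqrt : gamma = (sqrt_pow 1 (4 * 'X) n).1.
  by rewrite sqrt4 gammaE poly_def; apply: eq_bigr => j _; rewrite scaler_nat mulr_natl.
(* Both numbers are compared in [rat] as the coefficient of $t^i$ in $U_n(1, 4t)$, the generating
   polynomial of avoiding words by peaks. *)
apply/eqP; rewrite -(eqr_nat rat); apply/eqP.
transitivity (gamma`_i); last by rewrite gammaE coef_poly ltnS lei.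
rewrite gamma_sqrt; case: (n) hn => // n' _.
rewrite card_avoiding_abelian_dyck -(proj1 (sum_words_avoiding _ _)) coef_sum.
rewrite -sum1_count natr_sum big_mkcondr /=.
by apply: eq_bigr => u _; rewrite coefXn eq_sym; case: eqP.
Qed.
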